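(* Let $(C,d)$ be a complete metric cone, $Y$ a (real) Banach space and $D\subseteq Y$ a closed cone. Let $T:C\to Y$ be a continuous, additive (i.e. $T(u+v)=Tu+Tv$ for all $u,v\in C$) and positively homogeneous (i.e. $T(\lambda u)=\lambda Tu$ for all $u\in C$, $\lambda\ge 0$) map. Define the set-valued map $\Psi:C\to 2^{Y}$ by $\Psi(c):=Tc+D=\{Tc+d' : d'\in D\}$ for $c\in C$. If $\Psi$ is surjective, in the sense that for every $y\in Y$ there exists some $c\in C$ with $y\in\Psi(c)$, then the set $\Psi(\mathbb{B}_C):=\bigcup_{c\in\mathbb{B}_C}\Psi(c)\subseteq Y$ is open in $Y$, where $\mathbb{B}_C:=\{c\in C : d(0,c)<1\}$.
   Context: All vector spaces are over the reals. A cone in a vector space $V$ is a non-empty subset $D\subseteq V$ with $D+D\subseteq D$ and $\lambda D\subseteq D$ for all $\lambda\ge 0$ (it need not be proper, i.e. $D\cap(-D)=\{0\}$ is not required). An abstract cone is a set $C$ with operations $+:C\times C\to C$ and $\cdot:\mathbb{R}_{\ge 0}\times C\to C$ for which there exists an element $0\in C$ such that for all $u,v,w\in C$ and $\lambda,\mu\in\mathbb{R}_{\ge 0}$: $u+0=u$; $(u+v)+w=u+(v+w)$; $u+v=v+u$; $u+v=u+w$ implies $v=w$; $1u=u$; $(\lambda\mu)u=\lambda(\mu u)$; $(\lambda+\mu)u=\lambda u+\mu u$; $\lambda(u+v)=\lambda u+\lambda v$. A metric cone is a pair $(C,d)$ with $C$ an abstract cone and $d$ a metric on $C$ such that for all $u,v,w\in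 C$ and $\lambda\in\mathbb{R}_{\ge 0}$: $d(0,\lambda u)=\lambda d(0,u)$ and $d(u+v,u+w)\le d(v,w)$. It is complete if $(C,d)$ is a complete metric space. *)

(* Defs.v *)
From HB Require Import structures.
From mathcomp Require Import all_boot all_order all_algebra.
From mathcomp Require Import all_classical all_reals all_analysis.

Set Implicit Arguments.
Unset Strict Implicit.
Unset Printing Implicit Defensive.

Import Order.TTheory GRing.Theory Num.Theory.
Import numFieldNormedType.Exports.

Local Open Scope classical_set_scope.
Local Open Scope ring_scope.

(* The addition is not taken from nmodType: the library already has a structure
   that is both an nmodType and a pseudometric space but not a metric cone, which
   rules out a further structure of that kind. Scalars range over the type
   {nonneg R} of nonnegative reals, so nothing is said about negative ones. *)
HB.mixin Record isAbstractCone (R : realType) C := {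
  cone0 : C ;
  coneD : C -> C -> C ;
  coneZ : {nonneg R} -> C -> C ;
  coneD0 : forall u, coneD u cone0 = u ;
  coneDA : forall u v w, coneD (coneD u v) w = coneD u (coneD v w) ;
  coneDC : forall u v, coneD u v = coneD v u ;
  coneDI : forall u v w, coneD u v = coneD u w -> v = w ;
  coneZ1 : forall u, coneZ 1%:nng u = u ;
  coneZA : forall (l m : {nonneg R}) u,
    coneZ (l%:num * m%:num)%:nng u = coneZ l (coneZ m u) ;
  coneZDl : forall (l m : {nonneg R}) u,
    coneZ (l%:num + m%:num)%:nng u = coneD (coneZ l u) (coneZ m u) ;
  coneZDr : forall (l : {nonneg R}) u v,
    coneZ l (coneD u v) = coneD (coneZ l u) (coneZ l v)
}.

#[short(type="abstractConeType")]
HB.structure Definition AbstractCone (R : realType) :=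
  { C of isAbstractCone R C }.

HB.mixin Record Metric_isMetricCone (R : realType) C
    & AbstractCone R C & Metric R C := {
  mdist_cone0Z : forall (l : {nonneg R}) (u : C),
    mdist (cone0 : C) (coneZ l u) = l%:num * mdist (cone0 : C) u ;
  mdist_coneD2l : forall u v w : C,
    mdist (coneD u v) (coneD u w) <= mdist v w
}.

#[short(type="metricConeType")]
HB.structure Definition MetricCone (R : realType) :=
  { C of AbstractCone R C & Metric R C & Metric_isMetricCone R C }.

#[short(type="completeMetricConeType")]
HB.structure Definition CompleteMetricCone (R : realType) :=
  { C of MetricCone R C & Complete C }.

Definition is_cone (R : realType) (V : lmodType R) (D : set V) : Prop :=
  [/\ D !=set0,
      [set x + y | x in D & y in D] `<=` D
    & forall l : R, 0 <= l -> [set l *: x | x in D] `<=` D].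

Definition cone_unit_ball (R : realType) (C : metricConeType R) : set C :=
  [set c | mdist (cone0 : C) c < 1].

Definition cone_translate (R : realType) (C : Type) (Y : lmodType R)
    (T : C -> Y) (D : set Y) (c : C) : set Y :=
  [set T c + d | d in D].

(* Main.v *)
Require Import Defs.
From HB Require Import structures.
From mathcomp Require Import all_boot all_order all_algebra.
From mathcomp Require Import all_classical all_reals all_analysis.
From mathcomp Require Import lra.

Import Order.TTheory GRing.Theory Num.Theory.
Import numFieldNormedType.Exports.

Local Open Scope classical_set_scope.
Local Open Scope ring_scope.

(** The proof follows Banach's for the classical open mapping theorem. Write
    [U r] for the image under [Psi] of the open ball of radius [r] about the
    apex of [C] (this is [cone_translate_ball T D r]). Subadditivity and
    homogeneity of the distance to the apex, together with [D] being a convex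
    cone, give [U r + U s `<=` U (r + s)] and [l *: U r `<=` U (l * r)].

    Surjectivity says that [Y] is the union of the sets [U n], so by Baire's
    theorem some [closure (U n)] has an interior point [y0]
    ([cone_translate_ball_somewhere_dense]). A cone has no subtraction, so the
    usual passage from [y0] to the origin by symmetry is not available;
    instead surjectivity is used once more, on [- y0]: if [- y0] lies in [U m]
    then [closure (U (n + m))] contains a whole neighbourhood of [y0 - y0 = 0].
    By scaling, every [y] with [`|y| < t] is a limit of points of [U (M * t)]
    ([cone_translate_ball_near_dense]).

    The closure is then removed by successive approximation
    ([cone_translate_ball_nbhs0]): the error left after each step is halved,
    at the cost of adding to the current point of [C] an increment of
    geometrically decreasing size. These points [s n] converge to some [c]
    because [C] is complete, and the accumulated elements of [D], being
    [y - T (s n)] up to a vanishing error, converge to [y - T c], which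
    therefore belongs to the closed set [D]. So [U 1] is a neighbourhood of
    [0]. Finally, a point of [U 1] lies in [U (1 - e)] for some [e > 0], and
    adding [U e], a neighbourhood of [0], stays inside [U 1]. *)

(** * Metric cones *)

Section MetricCone.
Context {R : realType} {C : metricConeType R}.
Implicit Types u v : C.

(** Together with completeness, this is what lets series in [C] with summable
    distances to the apex converge, although terms cannot be subtracted. *)
Lemma mdist_coneD_self u v : mdist u (coneD u v) <= mdist (cone0 : C) v.
Proof. by rewrite -{1}[u]coneD0 mdist_coneD2l. Qed.

Lemma mdist_cone0D u v :
  mdist (cone0 : C) (coneD u v) <= mdist (cone0 : C) u + mdist (cone0 : C) v.
Proof.
by apply: le_trans (metric_triangle _ u _) _; rewrite lerD2l mdist_coneD_self.
Qed.

End MetricCone.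

Lemma geometric_half_cvg0 {R : realType} (a : R) :
  a * 2^-1 ^+ n @[n --> \oo] --> 0.
Proof. by apply: cvg_geometric; rewrite ger0_norm; lra. Qed.

(** The bound on [mdist (s 0) l] is the sum of the bounds on all the steps; it
    is what keeps the limit inside a ball of prescribed radius. *)
Lemma geometric_steps_cvg {R : realType} {C : completeMetricConeType R}
    (s : nat -> C) (a : R) :
  (forall n, mdist (s n) (s n.+1) <= a * 2^-1 ^+ n) ->
  exists2 l, s @ \oo --> l & mdist (s 0) l <= 2 * a.
Proof.
move=> sa.
have a0 : 0 <= a.
  by have := le_trans (mdist_ge0 _ _) (sa 0); rewrite expr0 mulr1.
(* The tail of the geometric series is kept in closed form, as the difference
   of two terms, so that the induction on [k] telescopes. *)
have tele n k :
    mdist (s n) (s (n + k)%N) <= 2 * a * 2^-1 ^+ n - 2 * a * 2^-1 ^+ (n + k)%N.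
  elim: k => [|k IH]; first by rewrite addn0 mdistxx subrr.
  rewrite addnS exprS.
  have := metric_triangle (s n) (s (n + k)%N) (s (n + k).+1%N).
  by have := sa (n + k); lra.
have tail n k : mdist (s n) (s (n + k)%N) <= 2 * a * 2^-1 ^+ n.
  apply: le_trans (tele n k) _; rewrite gerBl mulr_ge0// ?exprn_ge0//; lra.
have /cauchy_cvgP/cvg_ex[l sl] : cauchy (s @ \oo).
  apply: cauchy_exP => e e0.
  have [N _ /(_ N (leqnn N)) /=] :=
    cvgr_lt _ (geometric_half_cvg0 (2 * a)) _ e0.
  move=> aN; exists (s N); exists N => // n /= Nn.
  by rewrite ballEmdist /= -(subnKC Nn); apply: le_lt_trans (tail _ _) aN.
exists l => //; apply/ler_addgt0Pr => e e0.
have [N _ /(_ N (leqnn N)) /= lN] :=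
  metricType_numDomainType.cvgr_dist_lt sl e0.
have := metric_triangle (s 0) (s N) l; rewrite (metric_sym (s N)).
by have := tail 0 N; rewrite expr0 mulr1 add0n; lra.
Qed.

(** * Cones in a module and additive maps *)

Section ModuleCone.
Context {R : realType} {V : lmodType R} {D : set V} (D_cone : is_cone D).

Lemma is_coneD x y : D x -> D y -> D (x + y).
Proof.
by case: D_cone => _ DD _ Dx Dy; apply: DD; exists x => //; exists y.
Qed.

Lemma is_coneZ l x : 0 <= l -> D x -> D (l *: x).
Proof. by case: D_cone => _ _ DZ l0 Dx; apply: (DZ l l0); exists x. Qed.

Lemma is_cone0 : D 0.
Proof.
by case: (D_cone) => -[x Dx] _ _; rewrite -(scale0r x); exact: is_coneZ.
Qed.

End ModuleCone.

Lemma cone_additive0 {R : realType} {C : abstractConeType R} {V : zmodType}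
    (T : C -> V) :
  (forall u v, T (coneD u v) = T u + T v) -> T cone0 = 0.
Proof.
by move=> TD; apply: (@addrI _ (T cone0)); rewrite -TD coneD0 addr0.
Qed.

(** * Images of balls under the set-valued map *)

Definition cone_translate_ball {R : realType} {C : metricConeType R}
    {Y : lmodType R} (T : C -> Y) (D : set Y) (r : R) : set Y :=
  \bigcup_(c in [set c : C | mdist (cone0 : C) c < r]) cone_translate T D c.

Section AlgebraOfImages.
Context {R : realType} {C : metricConeType R} {Y : lmodType R}
  {T : C -> Y} {D : set Y} (D_cone : is_cone D).

Lemma cone_translate_ballD r s x y :
  (forall u v, T (coneD u v) = T u + T v) ->
  cone_translate_ball T D r x -> cone_translate_ball T D s y ->
  cone_translate_ball T D (r + s) (x + y).
Proof.
move=> TD [c /= cr [d Dd <-]] [c' /= cs [d' Dd' <-]]; exists (coneD c c') => /=.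
  exact: le_lt_trans (mdist_cone0D _ _) (ltrD cr cs).
by exists (d + d'); [exact: is_coneD|rewrite TD addrACA].
Qed.

Lemma cone_translate_ballZ l r x :
  (forall (k : {nonneg R}) u, T (coneZ k u) = k%:num *: T u) ->
  0 < l -> cone_translate_ball T D r x ->
  cone_translate_ball T D (l * r) (l *: x).
Proof.
move=> TZ l0 [c /= cr [d Dd <-]]; exists (coneZ (NngNum (ltW l0)) c) => /=.
  by rewrite mdist_cone0Z /= ltr_pM2l.
exists (l *: d); first exact: is_coneZ (ltW l0) Dd.
by rewrite TZ scalerDr.
Qed.

End AlgebraOfImages.

(** * From density to neighbourhoods of the origin *)

Section OpenMapping.
Context {R : realType} {C : completeMetricConeType R}
  {Y : completeNormedModType R} {T : C -> Y} {D : set Y}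
  (D_cone : is_cone D)
  (T_additive : forall u v : C, T (coneD u v) = T u + T v)
  (T_homogeneous : forall (l : {nonneg R}) (u : C),
     T (coneZ l u) = l%:num *: T u)
  (Psi_surjective : forall y : Y, exists c : C, cone_translate T D c y).

Lemma cone_translate_ball_somewhere_dense :
  exists n : nat, interior (closure (cone_translate_ball T D n%:R)) !=set0.
Proof.
apply: contrapT => /forallNP noint.
(* A closed set with empty interior has an open dense complement; a point in
   all these complements would be missed by every [Psi c]. *)
have /Baire dense_cap : forall n : nat,
    open (~` closure (cone_translate_ball T D n%:R)) /\
    dense (~` closure (cone_translate_ball T D n%:R)).
  move=> n; split; first by apply: closed_openC; exact: closed_closure.
  move=> O [x Ox] oO; apply: contrapT => O0; apply: (noint n); exists x.
  suff : O `<=` interior (closure (cone_translate_ball T D n%:R)) by apply.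
  rewrite -open_subsetE//.
  by move=> z Oz; apply: contrapT => nz; apply: O0; exists z.
have [y [_ yP]] := dense_cap setT (ex_intro _ 0 I) openT.
have [c cy] := Psi_surjective y.
have /= := yP (Num.truncn (mdist (cone0 : C) c)).+1 I; apply.
apply: subset_closure; exists c => //=.
by have := truncnS_gt (mdist (cone0 : C) c).
Qed.

(** An interior point [y0] of [closure (U n)] is moved to the origin by adding
    some element [- y0] of [U m], and the resulting statement about one ball
    about [0] is spread to all radii by homogeneity, with a constant [M] that
    does not depend on the radius. *)
Lemma cone_translate_ball_near_dense :
  exists2 M : R, 0 < M & forall (t : R) (y : Y) (e : R),
    0 < e -> `|y| < t ->
    exists2 x, cone_translate_ball T D (M * t) x & `|y - x| < e.
Proof.
have [n [y0 /nbhs_ballP[r /= r0 rP]]] := cone_translate_ball_somewhere_dense.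
have [c [d Dd cd]] := Psi_surjective (- y0).
(* The balls are open: the radius has to exceed the distance to [c]. *)
set m := mdist (cone0 : C) c + 1.
have m0 : 0 < m by rewrite ltr_wpDl ?mdist_ge0.
have my0 : cone_translate_ball T D m (- y0).
  by exists c; [rewrite /= ltrDl|exists d].
exists ((n%:R + m) / r); first by rewrite divr_gt0 // ltr_wpDl.
move=> t y e e0 yt.
have t0 : 0 < t by exact: le_lt_trans (normr_ge0 _) yt.
(* Scaling by [l] turns the ball of radius [r], to which density applies, into
   the ball of radius [t] that contains [y]. *)
set l := t / r; have l0 : 0 < l by rewrite divr_gt0.
have /rP/(_ _ (nbhsx_ballx _ _ (divr_gt0 e0 l0)))[x [xP xe]] :
    ball y0 r (y0 + l^-1 *: y).
  rewrite -ball_normE /= opprD addrA subrr add0r normrN normrZ.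
  by rewrite gtr0_norm ?invr_gt0// mulrC ltr_pdivrMr// /l mulrC mulfVK ?gt_eqF.
exists (l *: (x - y0)).
  rewrite mulrAC -mulrA mulrC; apply: cone_translate_ballZ => //.
  exact: cone_translate_ballD.
move: xe; rewrite -ball_normE /= ltr_pdivlMr// => /le_lt_trans; apply.
rewrite mulrC -[X in X * _](gtr0_norm l0) -normrZ.
rewrite !scalerBr scalerDr scalerA mulfV ?gt_eqF// scale1r opprB.
by rewrite addrCA addrA.
Qed.

Context (D_closed : closed D) (T_continuous : continuous T).

(** The successive approximation carries a pair [p] made of a point of [C] and
    a point of [D] instead of a series in [Y]: the error that remains to be
    corrected is then [y - T p.1 - p.2], and closedness of [D] applies
    directly to the second components. *)
Lemma cone_translate_ball_nbhs0 :
  exists2 t : R, 0 < t & forall y, `|y| < t -> cone_translate_ball T D 1 y.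
Proof.
have [M M0 dense0] := cone_translate_ball_near_dense.
(* The increments have total size at most [2 * (M * t)], which this choice
   makes equal to [2 / 3], below the radius [1]. *)
pose t := (3 * M)^-1.
have t0 : 0 < t by rewrite invr_gt0 mulr_gt0.
exists t => // y yt.
pose res (p : C * Y) := y - T p.1 - p.2.
pose h n : R := t * 2^-1 ^+ n.
have h0 n : 0 < h n by rewrite mulr_gt0// exprn_gt0.
have /choice[F FP] : forall np : nat * (C * Y), exists q : C * Y,
    D np.2.2 -> `|res np.2| < h np.1 ->
    [/\ D q.2, `|res q| < h np.1.+1
      & mdist np.2.1 q.1 <= M * t * 2^-1 ^+ np.1].
  move=> [n p] /=.
  have [pn|pn] := pselect (`|res p| < h n); last by exists p => _ /pn.
  have [_ [c /= cM [d Dd <-]] xh] := dense0 _ _ _ (h0 n.+1) pn.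
  exists (coneD p.1 c, p.2 + d) => Dp _; split => /=.
  - exact: is_coneD.
  - suff -> : res (coneD p.1 c, p.2 + d) = res p - (T c + d) by [].
    by rewrite /res /= T_additive !opprD !addrA; congr (_ - _); rewrite addrAC.
  - by rewrite -mulrA; apply: le_trans (mdist_coneD_self _ _) (ltW cM).
pose p := fix p n := if n is k.+1 then F (k, p k) else (cone0, 0).
have pP n : D (p n).2 /\ `|res (p n)| < h n.
  elim: n => [|n [Dn rn]]; last by have [] := FP (n, p n) Dn rn.
  rewrite /res /h /= (cone_additive0 _ T_additive) !subr0 expr0 mulr1.
  by split => //; exact: is_cone0.
have [|c pc cM] := @geometric_steps_cvg _ _ (fun n => (p n).1) (M * t).
  by move=> n; have [Dn rn] := pP n; have [] := FP (n, p n) Dn rn.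
exists c.
  apply: le_lt_trans cM _.
  by rewrite /t invfM mulrA mulrAC mulrA mulfVK ?gt_eqF//; lra.
exists (y - T c); last by rewrite addrC subrK.
have Tpc : T (p n).1 @[n --> \oo] --> T c.
  exact: continuous_cvg (T_continuous c) pc.
have res0 : res (p n) @[n --> \oo] --> 0.
  apply/cvgrPdist_lt => e e0.
  have [N _ hN] := cvgr_lt _ (geometric_half_cvg0 t) _ e0.
  exists N => // n /hN /= hn; rewrite sub0r normrN.
  exact: lt_trans (pP n).2 hn.
(* The second components are [y - T (p n).1 - res (p n)], whence their limit. *)
have : y - T (p n).1 - res (p n) @[n --> \oo] --> y - T c - 0.
  by apply: cvgB => //; apply: cvgB => //; exact: cvg_cst.
rewrite subr0; apply: (closed_cvg D) => //.
apply: nearW => n.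
suff -> : y - T (p n).1 - res (p n) = (p n).2 by have [] := pP n.
by rewrite /res opprB addrC subrK.
Qed.

End OpenMapping.

Theorem theorem4p5 (R : realType) (C : completeMetricConeType R)
    (Y : completeNormedModType R) (D : set Y)
    (D_cone : is_cone D) (D_closed : closed D)
    (T : C -> Y)
    (T_continuous : continuous T)
    (T_additive : forall u v : C, T (coneD u v) = T u + T v)
    (T_homogeneous : forall (l : {nonneg R}) (u : C),
       T (coneZ l u) = l%:num *: T u)
    (Psi_surjective : forall y : Y, exists c : C, cone_translate T D c y) :
  open (\bigcup_(c in @cone_unit_ball R C) cone_translate T D c).
Proof.
have [t t0 tP] := cone_translate_ball_nbhs0 D_cone T_additive T_homogeneous
  Psi_surjective D_closed T_continuous.
rewrite openE => y [c /= c1 cy].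
(* Half of the gap, so that [c] still lies in the open ball of radius
   [1 - e]. *)
set e := (1 - mdist (cone0 : C) c) / 2.
have c1' : mdist (cone0 : C) c < 1 by [].
have e0 : 0 < e by rewrite divr_gt0// subr_gt0.
have yP : cone_translate_ball T D (1 - e) y.
  by exists c => //=; rewrite /e; lra.
apply/nbhs_ballP; exists (e * t); first exact: mulr_gt0.
move=> z; rewrite -ball_normE /= => yz.
have := tP (e^-1 *: (z - y)); rewrite normrZ gtr0_norm ?invr_gt0//.
rewrite mulrC ltr_pdivrMr// mulrC distrC => /(_ yz).
move=> /(cone_translate_ballZ D_cone _ _ _ T_homogeneous e0).
move=> /(cone_translate_ballD D_cone _ _ _ _ T_additive yP).
by rewrite mulr1 subrK scalerA mulfV ?gt_eqF// scale1r addrC subrK.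
Qed.
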